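(* Let $p,q\in L^2[0,\infty)$ be real-valued functions such that $$\limsup_{x\to\infty} x\sqrt{p(x)^2+q(x)^2}=A<\frac12 .$$ Then for every $\phi_0\in[0,\pi)$, the Dirac operator $L_{p,q}$ with the boundary condition $u(0)\sin\phi_0-v(0)\cos\phi_0=0$ has no eigenvalues in $(-\infty,\infty)$.
   Context: For real-valued functions $p,q\in L^2[0,\infty)$ (called potentials), the Dirac operator in canonical form on $L^2[0,\infty)\bigoplus L^2[0,\infty)$ is $$L_{p,q}\begin{pmatrix}u\\ v\end{pmatrix}=\begin{pmatrix}0&-1\\1&0\end{pmatrix}\frac{d}{dx}\begin{pmatrix}u\\ v\end{pmatrix}+\begin{pmatrix}-p&q\\ q&p\end{pmatrix}\begin{pmatrix}u\\ v\end{pmatrix}.$$ For $\phi_0\in[0,\pi)$, under the boundary condition $u(0)\sin\phi_0-v(0)\cos\phi_0=0$ the operator is self-adjoint. A real number $\lambda$ is an eigenvalue of $L_{p,q}$ under this boundary condition if there is a nontrivial solution $(u,v)^T$ ($u,v$ locally absolutely continuous on $[0,\infty)$, equation holding almost everywhere) of $L_{p,q}(u,v)^T=\lambda (u,v)^T$ that satisfies the boundary condition and belongs to $L^2[0,\infty)\bigoplus L^2[0,\infty)$. *)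

(* Defs.v *)
From mathcomp Require Import all_boot all_order all_algebra.
From mathcomp Require Import all_classical all_reals all_analysis.
From mathcomp Require Import complex.

Set Implicit Arguments.
Unset Strict Implicit.
Unset Printing Implicit Defensive.

Import Order.TTheory GRing.Theory Num.Theory.
Import numFieldNormedType.Exports.

Local Open Scope classical_set_scope.
Local Open Scope ring_scope.
Local Open Scope complex_scope.

(* A function on the half-line [0, +oo[ is represented by a total function on
   R; none of the notions below depends on its values on ]-oo, 0[. *)

Section dirac.
Context {R : realType}.
Implicit Types (f p q : R -> R) (u v : R -> R[i]).

(* L^2 membership of (the extension by 0 of) f; elements of L^2 are represented
   by functions rather than by classes modulo a.e. equality. *)
Definition L2_halfline f : Prop :=
  f \_ `[0, +oo[ \in Lfun (@lebesgue_measure R) 2%:E.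

Definition abs_cont (a b : R) f : Prop :=
  forall e : R, 0 < e -> exists2 d : R, 0 < d &
    forall (n : nat) (s t : 'I_n -> R),
      (forall i, a <= s i /\ s i <= t i /\ t i <= b) ->
      trivIset [set: 'I_n] (fun i => `]s i, t i[%classic) ->
      \sum_(i < n) (t i - s i) < d ->
      \sum_(i < n) `|f (t i) - f (s i)| < e.

Definition loc_abs_cont f : Prop := forall b : R, 0 <= b -> abs_cont 0 b f.

(* R[i]-valued functions of a real variable are treated componentwise. *)
Definition cpart_re u : R -> R := fun x => complex.Re (u x).
Definition cpart_im u : R -> R := fun x => complex.Im (u x).

Definition cL2_halfline u : Prop :=
  L2_halfline (cpart_re u) /\ L2_halfline (cpart_im u).

Definition cloc_abs_cont u : Prop :=
  loc_abs_cont (cpart_re u) /\ loc_abs_cont (cpart_im u).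

Definition cderivable u (x : R) : Prop :=
  derivable (cpart_re u) x 1 /\ derivable (cpart_im u) x 1.

Definition cderive u (x : R) : R[i] :=
  derive1 (cpart_re u) x +i* derive1 (cpart_im u) x.

(* J (u, v)' + V (u, v) with J = (0 -1; 1 0) and V = (-p q; q p). *)
Definition dirac_op p q u v (x : R) : R[i] * R[i] :=
  (- cderive v x - (p x)%:C * u x + (q x)%:C * v x,
   cderive u x + (q x)%:C * u x + (p x)%:C * v x).

Definition dirac_solution p q (lambda : R) u v : Prop :=
  [/\ cloc_abs_cont u, cloc_abs_cont v &
      {ae @lebesgue_measure R, forall x : R, 0 < x ->
        [/\ cderivable u x, cderivable v x &
            dirac_op p q u v x = (lambda%:C * u x, lambda%:C * v x)]}].

Definition boundary_condition (phi0 : R) u v : Prop :=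
  u 0 * (sin phi0)%:C - v 0 * (cos phi0)%:C = 0.

Definition dirac_eigenvalue p q (phi0 lambda : R) : Prop :=
  exists u v : R -> R[i],
    [/\ dirac_solution p q lambda u v,
        exists2 x : R, 0 <= x & (u x, v x) <> (0, 0),
        boundary_condition phi0 u v,
        cL2_halfline u &
        cL2_halfline v].

End dirac.

(* Main.v *)
Require Import Defs.
From mathcomp Require Import all_boot all_order all_algebra.
From mathcomp Require Import all_classical all_reals all_analysis.
From mathcomp Require Import measurable_realfun ring lra.
From mathcomp Require Import complex.

Import Order.TTheory GRing.Theory Num.Theory.
Import numFieldNormedType.Exports.

Local Open Scope classical_set_scope.
Local Open Scope ring_scope.

(** An eigenfunction would be too large at infinity to be square integrable.
    Let [E = |u|^2 + |v|^2].  Since [lambda], [p] and [q] are real, the [lambda]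
    terms cancel in [E'], and what remains is a quadratic form whose matrix has
    eigenvalues [+-2 r], where [r = sqrt (p^2 + q^2)]; hence [E' >= - 2 r E]
    almost everywhere ([energy_derivative]).  This differential inequality is
    used twice, each time by finding a positive weight [w] with
    [w' >= 2 r w], so that [w E] is nondecreasing.

    - [w = exp (x + int (p^2 + q^2))] works on the whole half-line because
      [2 r <= 1 + r^2], and it exists because [p] and [q] are in [L^2].  It plays
      the role of a uniqueness theorem: once [E] is positive it stays so
      ([energy_stays_positive]).
    - [w = x] works near infinity, where the hypothesis on the limit superior
      gives [x r <= 1/2].  Thus [x E(x) >= c > 0] eventually
      ([mul_energy_nondecreasing]), and [E >= c / x] is not integrable
      ([not_integrable_ge_inv]), whereas [u] and [v] are in [L^2].

    Both steps rest on the fact that an absolutely continuous function whose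
    derivative is nonnegative almost everywhere is nondecreasing
    ([abs_cont_nondecreasing]).  It is obtained by gluing local estimates along
    a partition ([gauge_induction]): around the points with a nonnegative
    derivative the function decreases by at most a small multiple of the length,
    and the remaining points lie in an open set of small measure, on which
    absolute continuity bounds the total variation. *)

(** * Monotonicity of absolutely continuous functions *)

(** This is Cousin's lemma on the existence of partitions subordinate to a
    gauge, phrased for an additive predicate on intervals so that no partition
    has to be manipulated.  The supremum of the points reachable from [a] is
    itself reachable, and nothing but [b] can stop there. *)
Lemma gauge_induction {R : realType} (a b : R) (P : R -> R -> Prop) :
  a <= b ->
  (forall x y z, x <= y -> y <= z -> P x y -> P y z -> P x z) ->
  (forall x, a <= x -> x <= b -> exists2 d : R, 0 < d &
    forall s t, a <= s -> s <= x -> x <= t -> t <= b -> t - s < d -> P s t) ->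
  P a b.
Proof.
move=> ab Padd Ploc.
pose S := [set x : R | a <= x <= b /\ P a x].
have Sa : S a.
  split; first by rewrite lexx.
  by have [d d0 +] := Ploc a (lexx _) ab; apply; rewrite ?lexx ?subrr.
have Sub : ubound S b by move=> x [/andP[]].
have supS : has_sup S by split; [exists a | exists b].
have ac : a <= sup S by exact: ub_le_sup supS.2 _ Sa.
have cb : sup S <= b by exact: ge_sup supS.1 Sub.
have [d d0 Pd] := Ploc _ ac cb.
have [x [/andP[ax xb] Pax] cx] := sup_adherent (divr_gt0 d0 (ltr0n _ 2)) supS.
have xc : x <= sup S by apply: ub_le_sup supS.2 _ _; split; rewrite // ax.
(* [y] goes past the supremum, by a quarter of the gauge so that [y - x < d],
   unless [b] is reached before. *)
have [y [cy yb yd eqb]] : exists y : R,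
    [/\ sup S <= y, y <= b, y - x < d & y <= sup S -> y = b].
  have [h|h] := leP b (sup S + d / 4).
    by exists b; split=> //; lra.
  by exists (sup S + d / 4); split; lra.
have Sy : S y.
  split; first by rewrite (le_trans ac cy).
  apply: (Padd a x y) => //; first exact: le_trans cy.
  by apply: Pd.
by rewrite -(eqb (ub_le_sup supS.2 Sy)); case: Sy.
Qed.

Section monotone.
Context {R : realType}.
Notation mu := (@lebesgue_measure R).

Lemma null_sub_open (N : set R) (d : R) : 0 < d -> mu.-negligible N ->
  exists U : set R, [/\ open U, N `<=` U & (mu U < d%:E)%E].
Proof.
move=> d0 [D [mD D0 ND]].
have [|U [oU DU Ud]] := lebesgue_regularity_outer mD _ d0.
  by rewrite [X in (X < _)%E]D0 ltry.
exists U; split => //; first exact: subset_trans DU.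
have mU : measurable U by exact: open_measurable.
apply: le_lt_trans Ud; rewrite -{1}(setDUK DU).
have := @measureU2 _ _ _ mu D (U `\` D) mD (measurableD mU mD).
by rewrite [X in (_ <= X + _)%E -> _]D0 add0e.
Qed.

(** The interval straddles [x] instead of starting there, because the gauge
    induction tags an interval by any of its points. *)
Lemma derive1_ge0_local (F : R -> R) (x e : R) : 0 < e ->
  derivable F x 1 -> 0 <= derive1 F x ->
  exists2 d : R, 0 < d & forall s t, s <= x -> x <= t -> t - s < d ->
    F s - F t <= e * (t - s).
Proof.
move=> e0 dF; rewrite derive1E => F0.
have : (fun h : R => h^-1 *: ((F \o shift x) (h *: 1) - F x)) @ 0^' --> 'D_1 F x.
  exact: dF.
move=> /cvgrPdist_lt/(_ _ e0); rewrite near_withinE => /nbhs_ballP[d /= d0 Fd].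
have quot y : `|y - x| < d -> y != x -> - e < (y - x)^-1 * (F y - F x).
  move=> yx yneqx; have := Fd (y - x).
  rewrite /ball/= sub0r normrN subr_eq0 => /(_ yx yneqx).
  rewrite /shift/= scaler1 subrK ltr_norml => /andP[_].
  by rewrite /GRing.scale/=; lra.
exists d => // s t sx xt ts.
have Fs : F s - F x <= e * (x - s).
  have [->|sneqx] := eqVneq s x; first by rewrite !subrr mulr0.
  have s_lt : s < x by rewrite lt_neqAle sneqx.
  have h0 : s - x < 0 by rewrite subr_lt0.
  have := quot s; rewrite ltr_norml => /(_ _ sneqx).
  rewrite mulrC ltr_ndivlMr//; lra.
have Ft : F x - F t <= e * (t - x).
  have [->|tneqx] := eqVneq t x; first by rewrite !subrr mulr0.
  have t_gt : x < t by rewrite lt_neqAle eq_sym tneqx.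
  have h0 : 0 < t - x by rewrite subr_gt0.
  have := quot t; rewrite ltr_norml => /(_ _ tneqx).
  rewrite mulrC ltr_pdivlMr//; lra.
lra.
Qed.

(** The bad points, where the derivative is missing or negative, form a null set
    and are covered by an open [U] of measure less than the [d] that absolute
    continuity associates with [e].  Intervals tagged by a good point lose at
    most [e] times their length; those tagged by a bad point lie in [U], so
    their total length is less than [d] and they lose at most [e] together. *)
Lemma abs_cont_nondecreasing (a b : R) (F : R -> R) : a <= b ->
  abs_cont a b F ->
  {ae mu, forall x, a < x < b -> derivable F x 1 /\ 0 <= derive1 F x} ->
  F a <= F b.
Proof.
move=> ab acF aeF.
suff key e : 0 < e -> F a - F b <= e * (b - a) + e.
  have h0 : 0 < b - a + 1 by lra.
  rewrite -subr_le0; apply/ler_addgt0Pr => e e0; rewrite add0r.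
  have := key _ (divr_gt0 e0 h0).
  suff -> : e / (b - a + 1) * (b - a) + e / (b - a + 1) = e by [].
  by field; rewrite gt_eqF.
move=> e0; have [d d0 Fd] := acF _ e0.
set N := ~` [set x | a < x < b -> derivable F x 1 /\ 0 <= derive1 F x] in aeF.
(* Nothing is assumed at the endpoints, so they count as bad points. *)
have nN : mu.-negligible (N `|` ([set a] `|` [set b])).
  apply: negligibleU; first exact: aeF.
  by apply: negligibleU; apply/negligibleP;
    [exact: measurable_set1|exact: lebesgue_measure_set1
    |exact: measurable_set1|exact: lebesgue_measure_set1].
have [U [oU NU Ud]] := null_sub_open _ _ d0 nN.
have mU : measurable U by exact: open_measurable.
(* [l] lists, from left to right, the intervals tagged by a bad point.  Their
   total length is compared with the measure of [U] inside [s, t] only, which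
   is what makes the bound additive. *)
pose P s t := exists l : seq (R * R),
  [/\ all (fun i => [&& s <= i.1, i.1 <= i.2 & i.2 <= t]) l,
      pairwise (fun i j => i.2 <= j.1) l,
      ((\sum_(i <- l) (i.2 - i.1))%:E <= mu (U `&` `]s, t]))%E &
      F s - F t <= e * (t - s) + \sum_(i <- l) `|F i.2 - F i.1|].
have [l [lab lpw lU lF]] : P a b.
  apply: gauge_induction => //.
    move=> x y z xy yz [k [kxy kpw kU kF]] [l [lyz lpw lU lF]].
    exists (k ++ l); split.
    - rewrite all_cat; apply/andP; split.
        by apply: sub_all kxy => i /and3P[-> -> /= /le_trans]; apply.
      by apply: sub_all lyz => i /and3P[h -> ->]; rewrite (le_trans xy).
    - rewrite pairwise_cat kpw lpw !andbT; apply/allrelP => i j ik jl.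
      have /and3P[_ _ h1] := allP kxy i ik; have /and3P[h2 _ _] := allP lyz j jl.
      exact: le_trans h2.
    - rewrite big_cat/= EFinD; apply: (le_trans (leeD kU lU)).
      rewrite -measureU//; last 3 first.
      + exact: measurableI.
      + exact: measurableI.
      + apply/seteqP; split => // w /= [[_ +] [_ +]]; rewrite !in_itv/=.
        by lra.
      rewrite le_measure// ?inE//.
      + by apply: measurableU; exact: measurableI.
      + exact: measurableI.
      + move=> w /= [] [Uw]; rewrite in_itv/= => /andP[h1 h2]; split => //;
          rewrite in_itv/=; apply/andP; split; lra.
    - by rewrite big_cat/=; lra.
  move=> x ax xb; have [Ux|Ux] := pselect (U x).
    have /nbhs_ballP[r /= r0 rU] : nbhs x U by exact: open_nbhs_nbhs.
    exists r => // s t as_ sx xt tb tsr; exists [:: (s, t)] => /=; split.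
    - by rewrite !lexx (le_trans sx xt).
    - by [].
    - rewrite big_seq1/=; have -> : U `&` `]s, t] = `]s, t]%classic.
        rewrite setIidr// => w /=; rewrite in_itv/= => /andP[sw wt]; apply: rU.
        by rewrite /ball/= ltr_norml; apply/andP; split; lra.
      rewrite lebesgue_measure_itv/= lte_fin.
      by case: ltP => //; rewrite lee_fin; lra.
    - rewrite big_seq1/= -normrN opprB.
      have := ler_norm (F s - F t).
      have : 0 <= e * (t - s) by apply: mulr_ge0; lra.
      lra.
  have nNx : ~ N x by move=> Nx; apply: Ux; apply: NU; left.
  have xneqa : x <> a by move=> xa; apply: Ux; apply: NU; right; left.
  have xneqb : x <> b by move=> xa; apply: Ux; apply: NU; right; right.
  move/contrapT : nNx => /= [].
    by rewrite !lt_neqAle ax xb !andbT eq_sym; apply/andP; split; apply/eqP.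
  move=> dF F0; have [r r0 rF] := derive1_ge0_local _ _ _ e0 dF F0.
  exists r => // s t as_ sx xt tb tsr; exists [::]; split => //.
    by rewrite big_nil.
  by rewrite big_nil addr0; exact: rF.
apply: (le_trans lF); rewrite lerD2l; apply: ltW.
rewrite (big_nth (0, 0)) big_mkord.
apply: (Fd (size l) (fun i => (nth (0, 0) l i).1) (fun i => (nth (0, 0) l i).2)).
- by move=> i; have /and3P[] := allP lab _ (mem_nth (0, 0) (ltn_ord i)).
- have pw := pairwiseP (0, 0) lpw.
  move=> i j _ _ [x /= []]; rewrite !in_itv/= => /andP[h1 h2] /andP[h3 h4].
  apply: val_inj; case: (ltngtP i j) => // ij.
    have le_ij := pw i j (ltn_ord i) (ltn_ord j) ij.
    by have := lt_trans (lt_le_trans h2 le_ij) h3; rewrite ltxx.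
  have le_ji := pw j i (ltn_ord j) (ltn_ord i) ij.
  by have := lt_trans (lt_le_trans h4 le_ji) h1; rewrite ltxx.
- rewrite -lte_fin.
  rewrite -(big_mkord xpredT (fun i => (nth (0, 0) l i).2 - (nth (0, 0) l i).1)).
  rewrite -(big_nth (0, 0) xpredT (fun i => i.2 - i.1)).
  apply: le_lt_trans Ud; apply: (le_trans lU).
  by rewrite le_measure// ?inE//; exact: measurableI.
Qed.

End monotone.

(** * Operations on absolutely continuous functions *)

Section absolute_continuity.
Context {R : realType}.
Notation mu := (@lebesgue_measure R).
Implicit Types (a b : R) (f g h : R -> R).

Lemma abs_cont_subitv a b c d f : a <= c -> d <= b ->
  abs_cont a b f -> abs_cont c d f.
Proof.
move=> ac db acf e /acf[r r0 rf]; exists r => // n s t st; apply: rf => i.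
by have [cs [sst td]] := st i; split; [|split] => //;
  [exact: le_trans cs|exact: le_trans db].
Qed.

(** A single criterion for sums, products and compositions with a locally
    Lipschitz function: it is enough that increments of [h] are controlled by
    those of [f] and [g]. *)
Lemma abs_cont_dominated a b K f g h : 0 <= K ->
  (forall s t, a <= s -> s <= t -> t <= b ->
    `|h t - h s| <= K * (`|f t - f s| + `|g t - g s|)) ->
  abs_cont a b f -> abs_cont a b g -> abs_cont a b h.
Proof.
move=> K0 hfg acf acg e e0.
have e'0 : 0 < e / (2 * (K + 1)) by apply: divr_gt0 => //; lra.
have [d d0 df] := acf _ e'0; have [r r0 rg] := acg _ e'0.
exists (Num.min d r); first by rewrite lt_min d0.
move=> n s t st tst; rewrite lt_min => /andP[sumd sumr].
apply: (@le_lt_trans _ _ (K * (\sum_(i < n) `|f (t i) - f (s i)| +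
                              \sum_(i < n) `|g (t i) - g (s i)|))).
  rewrite -big_split/= mulr_sumr; apply: ler_sum => i _.
  by have [? []] := st i; exact: hfg.
have := df n s t st tst sumd; have := rg n s t st tst sumr.
set x := \sum_(i < n) _; set y := \sum_(i < n) _ => xe ye.
have xy : x + y <= e / (K + 1).
  have -> : e / (K + 1) = e / (2 * (K + 1)) + e / (2 * (K + 1)).
    by field; lra.
  lra.
apply: le_lt_trans (_ : K * (e / (K + 1)) < e).
  by rewrite addrC ler_wpM2l.
rewrite mulrCA gtr_pMr// ltr_pdivrMr; lra.
Qed.

Lemma abs_cont_id a b : abs_cont a b id.
Proof.
move=> e e0; exists e => // n s t st _; apply: le_lt_trans.
by apply: ler_sum => i _; have [_ [? _]] := st i; rewrite ger0_norm ?subr_ge0.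
Qed.

(** Locally, [f] varies by less than 1; boundedness is an additive property of
    intervals, so gauge induction makes it global. *)
Lemma abs_cont_bounded a b f : a <= b -> abs_cont a b f ->
  exists M : R, forall x, a <= x -> x <= b -> `|f x| <= M.
Proof.
move=> ab acf; have [d d0 df] := acf _ ltr01.
have small s t : a <= s -> s <= t -> t <= b -> t - s < d -> `|f t - f s| < 1.
  move=> as_ st tb tsd.
  have := df 1%N (fun _ => s) (fun _ => t); rewrite !big_ord1; apply => //.
  by move=> i j _ _ _; rewrite !ord1.
apply: (@gauge_induction _ a b
  (fun s t => exists M : R, forall x, s <= x -> x <= t -> `|f x| <= M)) => //.
  move=> x y z xy yz [M xyM] [N yzN]; exists (Num.max M N) => w xw wz.
  rewrite le_max; have [wy|/ltW yw] := leP w y.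
    by rewrite xyM.
  by rewrite yzN ?orbT.
move=> x ax xb; exists d => // s t as_ sx xt tb ts; exists (`|f x| + 1).
move=> y sy yt; have := ler_normD (f x) (f y - f x); rewrite subrKC.
have [xy|/ltW yx] := leP x y.
  by have := small x y; lra.
by have := small y x; rewrite distrC; lra.
Qed.

Lemma abs_contD a b f g : abs_cont a b f -> abs_cont a b g ->
  abs_cont a b (fun x => f x + g x).
Proof.
apply: (@abs_cont_dominated a b 1) => // s t _ _ _; rewrite mul1r.
by rewrite opprD addrACA ler_normD.
Qed.

Lemma abs_contM a b f g : a <= b -> abs_cont a b f -> abs_cont a b g ->
  abs_cont a b (fun x => f x * g x).
Proof.
move=> ab acf acg.
have [M fM] := abs_cont_bounded _ _ _ ab acf.
have [N gN] := abs_cont_bounded _ _ _ ab acg.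
have M0 : 0 <= M by apply: le_trans (fM a _ ab).
have N0 : 0 <= N by apply: le_trans (gN a _ ab).
apply: (@abs_cont_dominated a b (M + N) f g) => //; first exact: addr_ge0.
move=> s t as_ st tb.
have -> : f t * g t - f s * g s = f t * (g t - g s) + g s * (f t - f s) by ring.
apply: (le_trans (ler_normD _ _)); rewrite !normrM.
have h1 : `|f t| * `|g t - g s| <= M * `|g t - g s|.
  by apply: ler_wpM2r => //; apply: fM => //; exact: le_trans st.
have h2 : `|g s| * `|f t - f s| <= N * `|f t - f s|.
  by apply: ler_wpM2r => //; apply: gN => //; exact: le_trans tb.
have := mulr_ge0 M0 (normr_ge0 (f t - f s)).
have := mulr_ge0 N0 (normr_ge0 (g t - g s)).
lra.
Qed.

(** On the bounded range of [f] the exponential is Lipschitz; the constant comes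
    from [exp x - exp y = exp x (1 - exp (y - x)) <= exp x (x - y)]. *)
Lemma abs_cont_expR a b f : a <= b -> abs_cont a b f ->
  abs_cont a b (fun x => expR (f x)).
Proof.
move=> ab acf; have [M fM] := abs_cont_bounded _ _ _ ab acf.
have lip x y : x <= M -> y <= M -> expR x - expR y <= expR M * `|x - y|.
  move=> xM yM; have -> : expR y = expR x * expR (y - x).
    by rewrite -expRD subrKC.
  apply: (@le_trans _ _ (expR x * (x - y))).
    have := expR_ge1Dx (y - x); have := expR_gt0 x; nra.
  apply: (@le_trans _ _ (expR x * `|x - y|)).
    by rewrite ler_wpM2l ?expR_ge0// ler_norm.
  by rewrite ler_wpM2r// ler_expR.
apply: (@abs_cont_dominated a b (expR M) f f) => //; rewrite ?expR_ge0//.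
move=> s t as_ st tb.
have fsM : f s <= M.
  by apply: le_trans (ler_norm _) _; apply: fM => //; exact: le_trans tb.
have ftM : f t <= M.
  by apply: le_trans (ler_norm _) _; apply: fM => //; exact: le_trans st.
have := lip _ _ ftM fsM; have := lip _ _ fsM ftM; rewrite (distrC (f s)).
have := mulr_ge0 (expR_ge0 M) (normr_ge0 (f t - f s)).
by rewrite ler_norml; lra.
Qed.

(** The increments over disjoint intervals add up to the integral over their
    union, which is small when the measure of the union is small. *)
Lemma abs_cont_integral a b f : (forall x, 0 <= f x) ->
  mu.-integrable setT (EFin \o f) ->
  abs_cont a b (fun x => \int[mu]_(y in `]-oo, x]) f y).
Proof.
move=> f0 intf e e0.
have [d [d0 df]] := integral_normr_continuous intf e0.
have intfS A : measurable A -> mu.-integrable A (EFin \o f).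
  by move=> mA; apply: integrableS intf.
exists d => // n s t st tst sumd.
have mst i : measurable (`]s i, t i[%classic : set R) by exact: measurable_itv.
pose U := \big[setU/set0]_(i < n) `]s i, t i[%classic.
have mU : measurable U by exact: bigsetU_measurable.
have muU : (mu U < d%:E)%E.
  rewrite measure_semi_additive_ord//.
  rewrite (eq_bigr (fun i => (t i - s i)%:E)); first by rewrite sumEFin lte_fin.
  move=> i _; apply: etrans (lebesgue_measure_itv _) _; rewrite /= lte_fin.
  have [_ [+ _]] := st i; rewrite le_eqVlt => /predU1P[->|->//].
  by rewrite ltxx subrr.
have := df U mU muU; rewrite -!lte_fin; apply: le_lt_trans.
under [X in (_ <= X%:E)%E]eq_Rintegral do rewrite ger0_norm//.
rewrite /Rintegral fineK; last exact: integrable_fin_num (intfS _ mU).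
rewrite /U ge0_integral_bigsetU//; last 4 first.
- exact: index_enum_uniq.
- by apply: sub_trivIset tst.
- exact: measurable_int (intfS _ mU).
- by move=> x _; rewrite lee_fin.
rewrite -sumEFin; apply: lee_sum => i _.
have [as_ [sti tb]] := st i.
rewrite Rintegral_itvB//; last exact: intfS.
rewrite ger0_norm; last by apply: Rintegral_ge0.
rewrite -Rintegral_itv_bndo_bndc; last exact: intfS.
by rewrite /Rintegral fineK//; exact: integrable_fin_num (intfS _ _).
Qed.

End absolute_continuity.

(** * Weights, and a criterion of nonintegrability *)

Section weights.
Context {R : realType}.
Notation mu := (@lebesgue_measure R).

Lemma weighted_nondecreasing (a b : R) (w E : R -> R) : a <= b ->
  abs_cont a b w -> abs_cont a b E ->
  {ae mu, forall x, a < x < b -> exists dw dE : R,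
    [/\ is_derive x 1 w dw, is_derive x 1 E dE & 0 <= w x * dE + E x * dw]} ->
  w a * E a <= w b * E b.
Proof.
move=> ab acw acE h.
apply: (@abs_cont_nondecreasing R a b (fun x => w x * E x)) => //.
  exact: abs_contM.
apply: filterS h; first exact: (ae_filter_ringOfSetsType mu).
move=> x /[apply] -[dw [dE [w' E' ge0]]].
have wE' : is_derive x 1 (fun y => w y * E y) (w x * dE + E x * dw).
  exact: is_deriveM.
by split; [exact: ex_derive | rewrite derive1E derive_val].
Qed.

(** Comparison with the logarithm: the integral of [E] over [[X, Y]] is at least
    [c (ln Y - ln X)], which is unbounded in [Y]. *)
Lemma not_integrable_ge_inv (E : R -> R) (c X : R) : 0 < c -> 0 < X ->
  (forall x, X <= x -> c <= x * E x) ->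
  mu.-integrable `[0, +oo[ (EFin \o E) -> False.
Proof.
move=> c0 X0 cE intE.
have E0 x : X <= x -> 0 <= E x.
  move=> Xx; have x0 : 0 < x by exact: lt_le_trans Xx.
  by rewrite -(pmulr_rge0 _ x0); apply: le_trans (cE x Xx); exact: ltW.
have intXE : mu.-integrable `[X, +oo[ (EFin \o E).
  apply: integrableS intE => //; apply: subset_itvr; rewrite bnd_simp; exact: ltW.
pose I := \int[mu]_(x in `[X, +oo[) E x.
have lnI Y : X < Y -> c * (ln Y - ln X) <= I.
  move=> XY.
  have sXY : (`[X, Y]%classic : set R) `<=` `[X, +oo[%classic by exact: subset_itvl.
  have Xin x : x \in `[X, Y]%R -> 0 < x.
    by rewrite in_itv/= => /andP[+ _]; exact: lt_le_trans.
  have dcln (x : R) : 0 < x -> is_derive x 1 (fun y => c * ln y) (c * x^-1).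
    move=> x0; have := is_derive1_ln x0 => dln.
    exact: is_deriveZ.
  have ccont (x : R) : 0 < x -> {for x, continuous (fun y => c * ln y)}.
    by move=> x0; apply: cvgM; [exact: cvg_cst|exact: continuous_ln].
  have icont : {within `[X, Y], continuous (fun x : R => c * x^-1)}.
    apply: continuous_in_subspaceT => x; rewrite inE/= => /Xin x0.
    by apply: cvgM; [exact: cvg_cst|apply: cvgV => //; rewrite gt_eqF].
  have lnLR : derivable_oo_LRcontinuous (fun x : R => c * ln x) X Y.
    split.
    - move=> x xXY; have := dcln x (Xin _ (subset_itv_oo_cc xXY)) => ?.
      exact: ex_derive.
    - by apply: cvg_at_right_filter; exact: ccont.
    - by apply: cvg_at_left_filter; apply: ccont; exact: lt_trans XY.
  have lnD : {in `]X, Y[, derive1 (fun x : R => c * ln x) =1 (fun x => c * x^-1)}.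
    move=> x xXY; have := dcln x (Xin _ (subset_itv_oo_cc xXY)) => ?.
    by rewrite derive1E derive_val.
  have cint := continuous_FTC2 XY icont lnLR lnD.
  have : ((c * ln Y)%:E - (c * ln X)%:E <= I%:E)%E.
    rewrite -cint /I /Rintegral fineK; last exact: integrable_fin_num intXE.
    apply: (@le_trans _ _ (\int[mu]_(x in `[X, Y]) (E x)%:E)%E).
      apply: ge0_le_integral => //.
      - by move=> x /= /Xin x0; rewrite lee_fin mulr_ge0 ?invr_ge0// ltW.
      - apply/measurable_EFinP; apply: subspace_continuous_measurable_fun => //.
      - apply: measurable_funS (measurable_int _ intXE) => //.
      move=> x /= xXY; have x0 := Xin _ xXY.
      rewrite lee_fin ler_pdivrMr// mulrC cE//.
      by move: xXY; rewrite in_itv/= => /andP[].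
    apply: ge0_subset_integral => //; first exact: measurable_int intXE.
    by move=> x /=; rewrite in_itv/= => /andP[Xx _]; rewrite lee_fin E0.
  by rewrite -EFinB lee_fin mulrBr.
have I0 : 0 <= I.
  by apply: Rintegral_ge0 => x /=; rewrite in_itv/= => /andP[Xx _]; exact: E0.
(* This choice of [Y] makes the lower bound equal to [I + 1]. *)
have := lnI (X * expR ((I + 1) / c)).
rewrite lnM ?posrE ?expR_gt0// expRK ltr_pMr// expR_gt1.
have -> : c * (ln X + (I + 1) / c - ln X) = I + 1 by field; rewrite gt_eqF.
have h0 : 0 < (I + 1) / c by apply: divr_gt0 => //; lra.
by move=> /(_ h0); lra.
Qed.

End weights.

(** * The energy of a solution of the Dirac system *)

Section energy.
Context {R : realType}.
Notation mu := (@lebesgue_measure R).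
Local Open Scope complex_scope.
Implicit Types (u v : R -> R[i]) (p q : R -> R).

Definition energy u v (x : R) : R :=
  cpart_re u x ^+ 2 + cpart_im u x ^+ 2 + (cpart_re v x ^+ 2 + cpart_im v x ^+ 2).

Lemma energy_ge0 u v x : 0 <= energy u v x.
Proof. by rewrite !addr_ge0// sqr_ge0. Qed.

Lemma energy_gt0 u v x : (u x, v x) <> (0, 0) -> 0 < energy u v x.
Proof.
move=> uv0; rewrite lt_neqAle energy_ge0 andbT eq_sym.
apply/eqP => E0; apply: uv0; move: E0; rewrite /energy /cpart_re /cpart_im.
case: (u x) (v x) => [a b] [c d] /= E0.
have /eqP := E0; rewrite paddr_eq0 ?addr_ge0 ?sqr_ge0//.
rewrite !paddr_eq0 ?sqr_ge0// !sqrf_eq0.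
by move=> /andP[/andP[/eqP-> /eqP->] /andP[/eqP-> /eqP->]].
Qed.

Lemma energy_abs_cont u v b : 0 <= b -> cloc_abs_cont u -> cloc_abs_cont v ->
  abs_cont 0 b (energy u v).
Proof.
move=> b0 [u1 u2] [v1 v2].
have sq (f : R -> R) : loc_abs_cont f -> abs_cont 0 b (fun x => f x ^+ 2).
  move=> acf; have := abs_contM _ _ _ _ b0 (acf _ b0) (acf _ b0).
  by under eq_fun do rewrite -expr2.
by apply: abs_contD; apply: abs_contD; exact: sq.
Qed.

(** Cauchy-Schwarz for [(q, -p)] and [(c^2 - a^2, 2 a c)], the latter having
    norm [a^2 + c^2]; the difference of the squares is a square by Lagrange's
    identity. *)
Lemma quad_form_ge (p q a c : R) :
  - (Num.sqrt (p ^+ 2 + q ^+ 2) * (a ^+ 2 + c ^+ 2)) <=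
  q * (c ^+ 2 - a ^+ 2) - 2 * (p * (a * c)).
Proof.
set r := Num.sqrt _; set X := q * _ - _; set y := r * _.
have y0 : 0 <= y by rewrite mulr_ge0 ?sqrtr_ge0// addr_ge0// sqr_ge0.
have r2 : r ^+ 2 = p ^+ 2 + q ^+ 2 by rewrite sqr_sqrtr// addr_ge0// sqr_ge0.
have Xy : X ^+ 2 <= y ^+ 2.
  rewrite /y exprMn r2 -subr_ge0.
  suff -> : (p ^+ 2 + q ^+ 2) * (a ^+ 2 + c ^+ 2) ^+ 2 - X ^+ 2 =
    (p * (c ^+ 2 - a ^+ 2) + 2 * (q * (a * c))) ^+ 2 by exact: sqr_ge0.
  by rewrite /X; ring.
move: Xy; rewrite -ler_sqrt ?sqr_ge0// !sqrtr_sqr (ger0_norm y0) ler_norml.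
by case/andP.
Qed.

(** Real and imaginary parts of [(u, v)] separately solve the real system, in
    which [a a' + c c' = q (c^2 - a^2) - 2 p a c] for [a] and [c] the parts of
    [u] and [v]: the contributions of [lambda] cancel. *)
Lemma energy_derivative p q lambda u v x :
  cderivable u x -> cderivable v x ->
  dirac_op p q u v x = (lambda%:C * u x, lambda%:C * v x) ->
  exists2 dE : R, is_derive x 1 (energy u v) dE &
    - (2 * Num.sqrt (p x ^+ 2 + q x ^+ 2) * energy u v x) <= dE.
Proof.
move=> [du1 du2] [dv1 dv2] opE.
have d1 (f : R -> R) : derivable f x 1 -> is_derive x 1 f (derive1 f x).
  by move=> df; rewrite derive1E; exact/derivableP.
have sq (f : R -> R) : derivable f x 1 ->
    is_derive x 1 (fun y => f y ^+ 2) (2 * (f x * derive1 f x)).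
  move=> /d1 df; have -> : (fun y => f y ^+ 2) = (fun y => f y * f y).
    by apply/funext => y; rewrite expr2.
  have : is_derive x 1 (fun y => f y * f y) (f x *: derive1 f x + f x *: derive1 f x).
    exact: is_deriveM.
  by rewrite -mulr2n mulr_natl.
exists (2 * (cpart_re u x * derive1 (cpart_re u) x) +
        2 * (cpart_im u x * derive1 (cpart_im u) x) +
        (2 * (cpart_re v x * derive1 (cpart_re v) x) +
         2 * (cpart_im v x * derive1 (cpart_im v) x))).
  have h1 := sq _ du1; have h2 := sq _ du2.
  have h3 := sq _ dv1; have h4 := sq _ dv2.
  have h12 := is_deriveD h1 h2; have h34 := is_deriveD h3 h4.
  exact: (is_deriveD h12 h34).
move: opE; rewrite /dirac_op /cderive /energy.
move: (derive1 _ x) (derive1 _ x) (derive1 _ x) (derive1 _ x) => da db dc dd.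
rewrite /cpart_re /cpart_im.
case: (u x) (v x) => [a b] [c d] /= [e1 e2 e3 e4].
have := quad_form_ge (p x) (q x) a c; have := quad_form_ge (p x) (q x) b d.
move: e1 e2 e3 e4; move: da db dc dd.
set r := Num.sqrt _; move: (p x) (q x) r => P Q r da db dc dd e1 e2 e3 e4.
have -> : da = lambda * d - Q * b - P * d :> R by lra.
have -> : db = lambda * c - Q * a - P * c :> R by lra.
have -> : dc = - lambda * b - P * b + Q * d :> R by lra.
have -> : dd = - lambda * a - P * a + Q * c :> R by lra.
lra.
Qed.

Lemma energy_derivative_ae p q lambda u v : dirac_solution p q lambda u v ->
  {ae mu, forall x : R, 0 < x -> exists2 dE : R, is_derive x 1 (energy u v) dE &
    - (2 * Num.sqrt (p x ^+ 2 + q x ^+ 2) * energy u v x) <= dE}.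
Proof.
move=> [_ _]; apply: filterS; first exact: (ae_filter_ringOfSetsType mu).
by move=> x /[apply] -[]; exact: energy_derivative.
Qed.

Lemma L2_halfline_sqr (f : R -> R) : L2_halfline f ->
  mu.-integrable `[0, +oo[ (EFin \o (fun x => f x ^+ 2)).
Proof.
move=> /Lfun2_integrable_sqr intf.
have : mu.-integrable `[0, +oo[ (EFin \o (fun x => (f \_ `[0, +oo[) x ^+ 2)).
  exact: integrableS intf.
apply: eq_integrable => // x x0; rewrite /= patchE.
by rewrite x0.
Qed.

Lemma energy_integrable u v : cL2_halfline u -> cL2_halfline v ->
  mu.-integrable `[0, +oo[ (EFin \o energy u v).
Proof.
move=> [u1 u2] [v1 v2].
have := integrableD _ (integrableD _ (L2_halfline_sqr _ u1) (L2_halfline_sqr _ u2))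
  (integrableD _ (L2_halfline_sqr _ v1) (L2_halfline_sqr _ v2)).
by apply.
Qed.

(** A quantitative form of uniqueness for the Cauchy problem: a nontrivial
    solution vanishes nowhere to the right of a point where it is nonzero. *)
Lemma energy_stays_positive p q lambda u v x0 X :
  L2_halfline p -> L2_halfline q -> dirac_solution p q lambda u v ->
  0 <= x0 -> x0 <= X -> 0 < energy u v x0 -> 0 < energy u v X.
Proof.
move=> hp hq sol x00 x0X E0.
pose V (x : R) : R := (p \_ `[0, +oo[) x ^+ 2 + (q \_ `[0, +oo[) x ^+ 2.
have V0 x : 0 <= V x by rewrite addr_ge0// sqr_ge0.
have intV : mu.-integrable setT (EFin \o V).
  have := integrableD _ (Lfun2_integrable_sqr hp) (Lfun2_integrable_sqr hq).
  by apply.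
pose H (x : R) : R := \int[mu]_(y in `]-oo, x]) V y.
have acH : abs_cont x0 X H by exact: abs_cont_integral.
have dH : {ae mu, forall x : R, derivable H x 1 /\ derive1 H x = V x}.
  apply: FTC1Ny; first by move=> y; exact: integrableS intV.
  by apply: open_integrable_locally => //; exact: openT.
have [acu acv _] := sol.
have acE : abs_cont x0 X (energy u v).
  apply: abs_cont_subitv (energy_abs_cont _ _ X _ acu acv) => //.
  exact: le_trans x0X.
(* [w' = w (1 + V)] almost everywhere, and [1 + V = 1 + r^2 >= 2 r]. *)
pose w (x : R) : R := expR (x + H x).
have acw : abs_cont x0 X w.
  by apply: abs_cont_expR => //; apply: abs_contD => //; exact: abs_cont_id.
have : w x0 * energy u v x0 <= w X * energy u v X.
  apply: weighted_nondecreasing => //.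
  apply: filterS2 dH (energy_derivative_ae _ _ _ _ _ sol).
    exact: (ae_filter_ringOfSetsType mu).
  move=> x [dHx HV] h /andP[x0x _]; have xgt0 := le_lt_trans x00 x0x.
  have [dE E' E'ge] := h xgt0.
  exists (w x * (1 + V x)), dE; split => //.
    have dH' : is_derive x 1 H (V x) by rewrite -HV derive1E; exact/derivableP.
    have dxH : is_derive x 1 (fun y => y + H y) (1 + V x) by exact: is_deriveD.
    exact: (is_derive1_comp (is_derive_expR _) dxH).
  have VE : V x = p x ^+ 2 + q x ^+ 2.
    by rewrite /V !patchE !mem_set//= in_itv/= andbT ltW.
  set r := Num.sqrt _ in E'ge.
  have r2 : r ^+ 2 = V x by rewrite sqr_sqrtr -VE.
  have -> : w x * dE + energy u v x * (w x * (1 + V x)) =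
      w x * (dE + energy u v x * (1 + V x)) by ring.
  rewrite mulr_ge0 ?expR_ge0//; rewrite -r2.
  have := mulr_ge0 (energy_ge0 u v x) (sqr_ge0 (1 - r)).
  lra.
have wX0 : 0 < w X by exact: expR_gt0.
move=> h; rewrite -(pmulr_rgt0 _ wX0); apply: lt_le_trans h.
by rewrite mulr_gt0// expR_gt0.
Qed.

(** [(x E)' = E + x E' >= E (1 - 2 x r) >= 0]: this is where the constant 1/2
    enters. *)
Lemma mul_energy_nondecreasing p q lambda u v M a b :
  dirac_solution p q lambda u v ->
  (forall x, M < x -> x * Num.sqrt (p x ^+ 2 + q x ^+ 2) <= 1 / 2) ->
  0 <= a -> M <= a -> a <= b -> a * energy u v a <= b * energy u v b.
Proof.
move=> sol small a0 Ma ab; have [acu acv _] := sol.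
apply: (weighted_nondecreasing a b id) => //; first exact: abs_cont_id.
  apply: abs_cont_subitv (energy_abs_cont _ _ b _ acu acv) => //.
  exact: le_trans ab.
apply: filterS (energy_derivative_ae _ _ _ _ _ sol).
  exact: (ae_filter_ringOfSetsType mu).
move=> x h /andP[ax _]; have [dE E' E'ge] := h (le_lt_trans a0 ax).
exists 1, dE; split => //; first exact: is_derive_id.
have := small x (le_lt_trans Ma ax); set r := Num.sqrt _ in E'ge * => xr.
have := ler_wpM2l (ltW (le_lt_trans a0 ax)) E'ge.
have := ler_wpM2r (energy_ge0 u v x) xr.
rewrite /=; lra.
Qed.

End energy.

(** * Absence of eigenvalues *)

Lemma limf_esup_lt_near (R : realType) (f : R -> R) (A B : R) :
  limf_esup (fun x => (f x)%:E) (pinfty_nbhs R) = A%:E -> A < B ->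
  exists M : R, forall x, M < x -> f x <= B.
Proof.
move=> fA AB; have : (limf_esup (fun x => (f x)%:E) (pinfty_nbhs R) < B%:E)%E.
  by rewrite fA lte_fin.
move=> /ereal_inf_lt[_ [V [M [_ MV]] <-] supB]; exists M => x Mx.
rewrite -lee_fin; apply: le_trans (ltW supB).
by apply: ereal_sup_ubound; exists x => //; exact: MV.
Qed.

Theorem theorem1p1 (R : realType) (p q : R -> R) (A : R)
    (hp : L2_halfline p) (hq : L2_halfline q)
    (hlimsup : limf_esup
       (fun x : R => (x * Num.sqrt (p x ^+ 2 + q x ^+ 2))%:E) (pinfty_nbhs R)
       = A%:E)
    (hA : A < 1 / 2) :
  forall phi0 : R, 0 <= phi0 < pi ->
  forall lambda : R, ~ dirac_eigenvalue p q phi0 lambda.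
Proof.
move=> phi0 _ lambda [u [v [sol [x0 x00 uv0] _ L2u L2v]]].
have [M small] := limf_esup_lt_near _ _ _ _ hlimsup hA.
(* The 1 ensures [X > 0], so that the lower bound [X E(X)] is positive. *)
pose X := Num.max (x0 + 1) M.
have x0X : x0 <= X by rewrite le_max; apply/orP; left; lra.
have X0 : 0 < X by rewrite lt_max; apply/orP; left; lra.
have EX : 0 < energy u v X.
  exact: (energy_stays_positive _ _ _ _ _ _ _ hp hq sol x00 x0X (energy_gt0 _ _ _ uv0)).
apply: (not_integrable_ge_inv (energy u v) (X * energy u v X) X) => //.
- by rewrite mulr_gt0.
- move=> x Xx; apply: (mul_energy_nondecreasing _ _ _ _ _ _ _ _ sol small) => //.
  + exact: ltW.
  + by rewrite le_max lexx orbT.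
- exact: energy_integrable.
Qed.
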